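(* Let $(\mathcal A,\wedge,\delta,\Delta,[\cdot\bullet\cdot])$ be a DGBV algebra over $\mathbf k$ satisfying the $\delta\Delta$-condition. Let $x(t)=x_1t+\cdots+x_nt^n+\cdots$ and $\bar x(t)=\bar x_1t+\cdots+\bar x_nt^n+\cdots$ be two formal power series with even coefficients in $\mathcal A$, both solving the Maurer–Cartan equation $$\delta\omega+\tfrac12[\omega\bullet\omega]=0,$$ such that $x_1,\bar x_1\in\operatorname{Ker}\delta\cap\operatorname{Ker}\Delta$ and $x_n,\bar x_n\in\operatorname{Im}\Delta$ for $n>1$. If $[x_1]=[\bar x_1]$ in $H(\mathcal A,\delta)$, then there exists $w(t)=w_1t+\cdots+w_nt^n+\cdots\in\mathcal A[[t]]$, with $\Delta w(t)$ having odd coefficients, such that $$\exp(\Delta w(t))\cdot x(t)=\bar x(t).$$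
   Context: Let $\mathbf k$ be a graded commutative associative unital algebra over $\mathbb Q$ and let $(\mathcal A,\wedge)$ be a graded commutative associative algebra with unit $1$ over $\mathbf k$ (only the parity $|a|$ of degrees matters for signs). DGBV algebra: for an odd linear operator $\Delta$ on $\mathcal A$ set $[a\bullet b]=(-1)^{|a|}\big(\Delta(a\wedge b)-(\Delta a)\wedge b-(-1)^{|a|}a\wedge\Delta b\big)$ for homogeneous $a,b$. If $\Delta^2=0$ and $[a\bullet(b\wedge c)]=[a\bullet b]\wedge c+(-1)^{(|a|-1)|b|}b\wedge[a\bullet c]$ for all homogeneous $a,b,c$, then $(\mathcal A,\wedge,\Delta,[\cdot\bullet\cdot])$ is a GBV algebra. A DGBV algebra is a GBV algebra with an odd $\mathbf k$-linear derivation $\delta$ of $\wedge$ such that $\delta^2=\delta\Delta+\Delta\delta=0$. $H(\mathcal A,\delta)=\operatorname{Ker}\delta/\operatorname{Im}\delta$. $\delta\Delta$-condition: $\operatorname{Im}\delta\Delta=\operatorname{Im}\delta\cap\operatorname{Ker}\Delta=\operatorname{Im}\Delta\cap\operatorname{Ker}\delta$ (equivalently, the inclusions $(\operatorname{Ker}\Delta,\delta)\hookrightarrow(\mathcal A,\delta)$ and $(\operatorname{Ker}\delta,\Delta)\hookrightarrow(\mathcal A,\Delta)$ induce isomorphisms on homology). $t$ is an even indeterminate and all operations are extended $t$-coefficientwise to $\mathcal A[[t]]$. Gauge action: with $\operatorname{ad}_A=[A\bullet\cdot]$, for $A\in t\mathcal A[[t]]$ with odd coefficients and $\omega\in t\mathcal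 A[[t]]$ with even coefficients, $$\exp(A)\cdot\omega=e^{\operatorname{ad}_A}\omega+\frac{1-e^{\operatorname{ad}_A}}{\operatorname{ad}_A}\,\delta A=\sum_{q\ge0}\frac1{q!}\operatorname{ad}_A^q\omega-\sum_{q\ge0}\frac1{(q+1)!}\operatorname{ad}_A^q\delta A .$$ *)

(* Defs.v *)
From mathcomp Require Import all_boot all_order all_algebra.
From mathcomp Require Import boolp classical_sets.

Set Implicit Arguments.
Unset Strict Implicit.
Unset Printing Implicit Defensive.

Import GRing.Theory.
Local Open Scope ring_scope.
Local Open Scope classical_set_scope.

(* Only the parity of a degree enters the signs, so gradings are taken over
   Z/2, encoded by bool with [true] odd and [addb] as addition: [G p] is the
   set of homogeneous elements of parity p.  A Z-grading induces such a grading
   by collecting even and odd degrees.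
   [pzRingType] rather than [nzRingType] is used so that the zero ring is not
   excluded; an algebra over a base ring is given by its structure morphism. *)

Record is_grading (V : zmodType) (G : bool -> set V) : Prop := {
  grading0 : forall p, G p 0;
  gradingB : forall p u v, G p u -> G p v -> G p (u - v);
  grading_sum : forall v, exists u0 u1, [/\ G false u0, G true u1 & v = u0 + u1];
  grading_direct : forall v, G false v -> G true v -> v = 0
}.

Record is_graded_comm_ring (A : pzRingType) (G : bool -> set A) : Prop := {
  graded_comm_ring_grading : is_grading G;
  graded1 : G false 1;
  gradedM : forall p q a b, G p a -> G q b -> G (p (+) q) (a * b);
  graded_mulC : forall p q a b,
    G p a -> G q b -> a * b = (-1) ^+ (p && q) * (b * a)
}.

(* The image of [phi] is automatically central in the graded sense. *)
Record is_graded_comm_alg (R A : pzRingType) (RG : bool -> set R)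
    (AG : bool -> set A) (phi : {rmorphism R -> A}) : Prop := {
  graded_comm_alg_ring : is_graded_comm_ring AG;
  graded_structure_map : forall p c, RG p c -> AG p (phi c)
}.

Definition even_grading (R : pzRingType) : bool -> set R :=
  fun p => if p then [set 0] else setT.

(* Linearity of an odd operator over the graded ring R carries the Koszul
   sign; this is forced for a derivation vanishing on the scalars. *)
Record is_odd_linear (R A : pzRingType) (RG : bool -> set R)
    (AG : bool -> set A) (phi : {rmorphism R -> A}) (D : A -> A) : Prop := {
  odd_linearD : forall a b, D (a + b) = D a + D b;
  odd_linearZ : forall p c a,
    RG p c -> D (phi c * a) = (-1) ^+ p * (phi c * D a);
  odd_linear_parity : forall p a, AG p a -> AG (~~ p) (D a)
}.

Definition component (V : zmodType) (G : bool -> set V) (p : bool) (v : V) : V :=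
  xget 0 [set u | G p u /\ G (~~ p) (v - u)].

(* The additive extension, from homogeneous a to all a, of
   [a . b] = (-1)^|a| (Delta (a b) - (Delta a) b - (-1)^|a| a (Delta b));
   see [bracket_homogeneous]. *)
Definition bracket (A : pzRingType) (G : bool -> set A) (Delta : A -> A)
    (a b : A) : A :=
  \sum_(p : bool) (-1) ^+ p *
    (Delta (component G p a * b) - Delta (component G p a) * b
     - (-1) ^+ p * (component G p a * Delta b)).

Lemma component_homogeneous (V : zmodType) (G : bool -> set V) (p q : bool)
    (v : V) :
  is_grading G -> G p v -> component G q v = if p == q then v else 0.
Proof.
move=> gG Gv.
have E : [set u | G q u /\ G (~~ q) (v - u)] (if p == q then v else 0).
  case: eqP => [<-|npq] /=; first by split; rewrite ?subrr //; apply: grading0.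
  split; first exact: grading0.
  by rewrite subr0; case: p q npq Gv => [] [].
rewrite /component; case: xgetP => [u _ [Gu Gvu]|/(_ _ E)[]//].
case: E => Ge Gve.
have G1 : G q (u - (if p == q then v else 0)) by exact: gradingB.
have G2 : G (~~ q) (u - (if p == q then v else 0)).
  have := gradingB gG Gve Gvu.
  by rewrite opprB addrC [X in G _ X]addrA subrK.
apply/eqP; rewrite -subr_eq0; apply/eqP.
by case: q {Gu Gvu Ge Gve} G1 G2 => G1 G2; apply: (grading_direct gG).
Qed.

Lemma bracket_homogeneous (A : pzRingType) (G : bool -> set A) (Delta : A -> A)
    (p : bool) (a b : A) :
  is_grading G -> Delta 0 = 0 -> G p a ->
  bracket G Delta a b =
    (-1) ^+ p * (Delta (a * b) - Delta a * b - (-1) ^+ p * (a * Delta b)).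
Proof.
move=> gG D0 Ga; rewrite /bracket (bigD1 p) //= big1 => [|q npq].
  by rewrite !(component_homogeneous _ gG Ga) eqxx addr0.
rewrite !(component_homogeneous _ gG Ga) eq_sym (negPf npq).
by rewrite !mul0r D0 mul0r mulr0 !subr0 mulr0.
Qed.

Record is_GBV (R A : pzRingType) (RG : bool -> set R) (AG : bool -> set A)
    (phi : {rmorphism R -> A}) (Delta : A -> A) : Prop := {
  GBV_alg : is_graded_comm_alg RG AG phi;
  GBV_odd_linear : is_odd_linear RG AG phi Delta;
  GBV_square : forall a, Delta (Delta a) = 0;
  (* (-1)^((|a|-1)|b|) is (-1)^(~~ p && q) *)
  GBV_Leibniz : forall p q r a b c, AG p a -> AG q b -> AG r c ->
    bracket AG Delta a (b * c) =
      bracket AG Delta a b * c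
      + (-1) ^+ (~~ p && q) * (b * bracket AG Delta a c)
}.

Record is_DGBV (R A : pzRingType) (RG : bool -> set R) (AG : bool -> set A)
    (phi : {rmorphism R -> A}) (Delta delta : A -> A) : Prop := {
  DGBV_GBV : is_GBV RG AG phi Delta;
  DGBV_odd_linear : is_odd_linear RG AG phi delta;
  DGBV_derivation : forall p a b, AG p a ->
    delta (a * b) = delta a * b + (-1) ^+ p * (a * delta b);
  DGBV_square : forall a, delta (delta a) = 0;
  DGBV_anticomm : forall a, delta (Delta a) + Delta (delta a) = 0
}.

Definition ker (V : zmodType) (D : V -> V) : set V := D @^-1` [set 0].

Definition deltaDelta_condition (V : zmodType) (delta Delta : V -> V) : Prop :=
  range (delta \o Delta) = range delta `&` ker Delta /\
  range delta `&` ker Delta = range Delta `&` ker delta.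

(* The class of a cycle in Ker delta / Im delta, as the coset a + Im delta. *)
Definition homology_class (V : zmodType) (delta : V -> V) (a : V) : set V :=
  [set a + b | b in range delta].

(* f : fps A stands for the formal power series \sum_n (f n) t^n. *)
Definition fps (A : Type) : Type := nat -> A.

(* t is even, so the coefficientwise extension involves no sign. *)
Definition fps_bracket (A : pzRingType) (G : bool -> set A) (Delta : A -> A)
    (f g : fps A) : fps A :=
  fun n => \sum_(i < n.+1) bracket G Delta (f i) (g (n - i)%N).

(* Here and below [qA] gives the multiplication of A by rational numbers. *)
Definition Maurer_Cartan (A : pzRingType) (G : bool -> set A)
    (Delta delta : A -> A) (qA : {rmorphism rat -> A}) (om : fps A) : Prop :=
  forall n, delta (om n) + qA (2%:R^-1) * fps_bracket G Delta om om n = 0.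

(* The sums over q converge t-adically when f has no constant term: ad_f raises
   the order in t, so the terms with q > n do not contribute to the coefficient
   of t^n; see [gauge_stable]. *)
Definition gauge (A : pzRingType) (G : bool -> set A) (Delta delta : A -> A)
    (qA : {rmorphism rat -> A}) (f om : fps A) : fps A :=
  fun n =>
    \sum_(q < n.+1) qA (q`!%:R^-1) * iter q (fps_bracket G Delta f) om n
    - \sum_(q < n.+1)
        qA ((q.+1)`!%:R^-1) * iter q (fps_bracket G Delta f) (delta \o f) n.

Lemma bracket0l (A : pzRingType) (G : bool -> set A) (Delta : A -> A) (b : A) :
  is_grading G -> Delta 0 = 0 -> bracket G Delta 0 b = 0.
Proof.
move=> gG D0; rewrite (bracket_homogeneous _ gG D0 (grading0 gG false)).
by rewrite !mul0r D0 mul0r mulr0 !subr0 mulr0.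
Qed.

Lemma bracket0r (A : pzRingType) (G : bool -> set A) (Delta : A -> A) (a : A) :
  Delta 0 = 0 -> bracket G Delta a 0 = 0.
Proof.
by move=> D0; rewrite /bracket big1 // => p _; rewrite !mulr0 D0 !mulr0 !subr0 mulr0.
Qed.

Lemma iter_bracket_eq0 (A : pzRingType) (G : bool -> set A) (Delta : A -> A)
    (f g : fps A) (q n : nat) :
  is_grading G -> Delta 0 = 0 -> f 0%N = 0 -> (n < q)%N ->
  iter q (fps_bracket G Delta f) g n = 0.
Proof.
move=> gG D0 f0; elim: q n => // q IH n nq.
rewrite iterS {1}/fps_bracket big1 // => -[[|i] ilt] _ /=.
  by rewrite f0 bracket0l.
rewrite IH ?bracket0r //; move: nq ilt; rewrite !ltnS => nq ilt.
by rewrite (leq_trans _ nq) // ltn_subrL /= (leq_trans _ ilt).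
Qed.

Lemma gauge_stable (A : pzRingType) (G : bool -> set A) (Delta delta : A -> A)
    (qA : {rmorphism rat -> A}) (f om : fps A) (n m : nat) :
  is_grading G -> Delta 0 = 0 -> f 0%N = 0 -> (n < m)%N ->
  gauge G Delta delta qA f om n =
    \sum_(q < m) qA (q`!%:R^-1) * iter q (fps_bracket G Delta f) om n
    - \sum_(q < m)
        qA ((q.+1)`!%:R^-1) * iter q (fps_bracket G Delta f) (delta \o f) n.
Proof.
move=> gG D0 f0 nm; rewrite /gauge.
have tr (c : nat -> A) (g : fps A) :
  \sum_(q < n.+1) c q * iter q (fps_bracket G Delta f) g n =
  \sum_(q < m) c q * iter q (fps_bracket G Delta f) g n.
  rewrite -!(big_mkord xpredT
    (fun q => c q * iter q (fps_bracket G Delta f) g n)).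
  rewrite [RHS](big_cat_nat (n := n.+1)) //=.
  rewrite [X in _ = _ + X]big_nat [X in _ = _ + X]big1 ?addr0 // => q /andP[nq _].
  by rewrite iter_bracket_eq0 ?mulr0.
by rewrite (tr (fun q => qA (q`!%:R^-1))) (tr (fun q => qA ((q.+1)`!%:R^-1))).
Qed.

(* Main.v *)
(* The series w is built one coefficient at a time.  Changing w_n changes the
   coefficient of t^n in y = exp(Delta w) . x by - delta (Delta w_n) and leaves
   the lower ones alone.  If y and xbar agree below t^n, then, both being
   Maurer-Cartan, delta (y_n - xbar_n) = 0, while y_n - xbar_n lies in Im Delta;
   so the delta-Delta condition writes it as delta (Delta u) with u even, and
   adding u to w_n makes y and xbar agree at t^n.  For n = 1 the equality of
   classes gives x_1 - xbar_1 in Im delta /\ Ker Delta = Im Delta /\ Ker delta.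
   No composition of gauge transformations (Baker-Campbell-Hausdorff) is needed.

   That the gauge action preserves the Maurer-Cartan equation is seen along the
   flow y(s) = exp(s f) . x, which solves y' = [f, y] - delta f: the curvature
   F = 2 delta y + [y, y] solves the linear equation F' = [f, F] with F(0) = 0,
   hence vanishes identically as a power series in s. *)

Require Import Defs.
From mathcomp Require Import all_boot all_order all_algebra.
From mathcomp Require Import boolp classical_sets functions.

Set Implicit Arguments.
Unset Strict Implicit.
Unset Printing Implicit Defensive.

Import GRing.Theory.
Local Open Scope ring_scope.
Local Open Scope classical_set_scope.

(** * Additive maps between abelian groups *)

Section AdditiveMaps.
Variables (U V : zmodType) (f : U -> V).
Hypothesis fD : {morph f : a b / a + b}.

Lemma morphD0 : f 0 = 0.
Proof. by apply: (addrI (f 0)); rewrite -fD !addr0. Qed.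

Lemma morphDN : {morph f : a / - a}.
Proof. by move=> a; apply: (addrI (f a)); rewrite -fD !subrr morphD0. Qed.

Lemma morphDB : {morph f : a b / a - b}.
Proof. by move=> a b; rewrite fD morphDN. Qed.

Lemma morphDMn n : {morph f : a / a *+ n}.
Proof. by move=> a; elim: n => [|n IH]; rewrite ?morphD0 // !mulrS fD IH. Qed.

Lemma morphD_sum I (r : seq I) (P : pred I) (F : I -> U) :
  f (\sum_(i <- r | P i) F i) = \sum_(i <- r | P i) f (F i).
Proof. exact: (big_morph f fD morphD0). Qed.

End AdditiveMaps.

Lemma subrACA3 (V : zmodType) (a b c a' b' c' : V) :
  (a + a') - (b + b') - (c + c') = (a - b - c) + (a' - b' - c').
Proof. by rewrite !opprD [X in X + _]addrACA [LHS]addrACA. Qed.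

(** * Reindexing of convolution sums *)

Section ConvolutionSums.
Variable V : zmodType.
Implicit Type F : nat -> nat -> V.

Lemma sum_triangle F n :
  \sum_(i < n.+1) \sum_(j < i.+1) F j (i - j)%N =
  \sum_(i < n.+1) \sum_(j < (n - i).+1) F i j.
Proof.
elim: n => [|n IH]; first by rewrite !big_ord1.
rewrite big_ord_recr /= IH [RHS]big_ord_recr /= subnn big_ord1.
rewrite [X in _ + X = _]big_ord_recr /= subnn addrA -big_split /=.
congr (_ + _); apply: eq_bigr => i _.
by rewrite subSn ?leq_ord // [RHS]big_ord_recr.
Qed.

Lemma sum_conv_rev F n :
  \sum_(i < n.+1) F i (n - i)%N = \sum_(i < n.+1) F (n - i)%N i.
Proof.
rewrite (reindex_inj rev_ord_inj); apply: eq_bigr => i _ /=.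
by rewrite subSS subKn ?leq_ord.
Qed.

Lemma sum_triangleC F n :
  \sum_(i < n.+1) \sum_(j < (n - i).+1) F i j =
  \sum_(i < n.+1) \sum_(j < (n - i).+1) F j i.
Proof.
rewrite -sum_triangle -(sum_triangle (fun i j => F j i)); apply: eq_bigr => i _.
exact: (sum_conv_rev F).
Qed.

(** Regroups a product of two truncated series by total degree; the part of the square outside the
    triangle i + j <= n contributes nothing. *)
Lemma sum_square F N n :
    (forall i j, (n < i + j)%N -> F i j = 0) -> (n < N)%N ->
  \sum_(i < N) \sum_(j < N) F i j =
  \sum_(m < n.+1) \sum_(i < m.+1) F i (m - i)%N.
Proof.
move=> F0 nN; rewrite sum_triangle.
have trunc (G : nat -> V) k : (k < N)%N -> (forall j, (k < j)%N -> G j = 0) ->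
    \sum_(j < N) G j = \sum_(j < k.+1) G j.
  move=> kN G0; rewrite -!(big_mkord xpredT G) (big_cat_nat (n := k.+1)) //=.
  rewrite [X in _ + X]big_nat [X in _ + X]big1 ?addr0 // => j /andP[kj _].
  exact: G0.
rewrite (trunc (fun i => \sum_(j < N) F i j) n) // => [|i ni].
  apply: eq_bigr => i _; rewrite (trunc (F i) (n - i)%N) //.
    by apply: leq_ltn_trans nN; rewrite leq_subr.
  by move=> j nij; apply: F0; rewrite -ltn_subLR ?leq_ord.
by rewrite big1 // => j _; apply: F0; rewrite ltn_addr.
Qed.

End ConvolutionSums.

(** * The curvature along the gauge flow, in an abstract setting *)

Section GaugeFlow.
Variables (L : zmodType) (Br : L -> L -> L) (dl : L -> L) (E : set L) (f : L).
Hypothesis torsion_free : forall (n : nat) (a : L), a *+ n.+1 = 0 -> a = 0.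
Hypothesis BrDl : forall b, {morph Br^~ b : a a' / a + a'}.
Hypothesis BrDr : forall a, {morph Br a : b b' / b + b'}.
Hypothesis dlD : {morph dl : a b / a + b}.
Hypothesis dl2 : dl (dl f) = 0.
Hypothesis Edlf : E (dl f).
Hypothesis EBr : forall a, E a -> E (Br f a).
Hypothesis BrC : forall a b, E a -> E b -> Br a b = Br b a.
Hypothesis dlBr : forall a, E a -> dl (Br f a) = Br (dl f) a + Br f (dl a).
Hypothesis BrJ : forall a b, E a -> E b ->
  Br f (Br a b) = Br (Br f a) b + Br a (Br f b).

(** [y q] stands for the coefficient of s^q along the flow; [yS] is y' = [f, y] - delta f read
    coefficientwise, with denominators cleared. *)
Variable y : nat -> L.
Hypothesis Ey : forall q, E (y q).
Hypothesis yS : forall q, y q.+1 *+ q.+1 = Br f (y q) - dl f *+ (q == 0%N).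

(* Coefficient of s^q in the curvature 2 delta y(s) + [y(s), y(s)]. *)
Definition MC_flow q := dl (y q) *+ 2 + \sum_(i < q.+1) Br (y i) (y (q - i)%N).

(** The Leibniz rule and symmetry on [E] produce two sums exchanged by i -> q - i. *)
Lemma sum_flow q :
  (\sum_(i < q.+1) Br (Br f (y i)) (y (q - i)%N)) *+ 2 =
  Br f (\sum_(i < q.+1) Br (y i) (y (q - i)%N)).
Proof.
rewrite (morphD_sum (BrDr f)).
rewrite [RHS](eq_bigr (fun i : 'I_q.+1 => Br (Br f (y i)) (y (q - i)%N) +
    Br (Br f (y (q - i)%N)) (y i))); last first.
  by move=> i _; rewrite BrJ //; congr (_ + _); apply: BrC => //; apply: EBr.
rewrite big_split /=.
by rewrite -(sum_conv_rev (fun i j => Br (Br f (y i)) (y j))) mulr2n.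
Qed.

(* By symmetry of the bracket, (q+1) sum_i [y_i, y_(q+1-i)] equals
   2 sum_i [i y_i, y_(q+1-i)], to which the equation of the flow applies. *)
Lemma MC_flowS q : MC_flow q.+1 *+ q.+1 = Br f (MC_flow q).
Proof.
rewrite /MC_flow mulrnDl BrDr (morphDMn (BrDr f)) -sum_flow.
(* Since delta (delta f) = 0, the only extra term is [delta f, y_q]; it cancels against the one from
   the quadratic part. *)
have -> : dl (y q.+1) *+ 2 *+ q.+1 =
    (Br (dl f) (y q) + Br f (dl (y q))) *+ 2.
  rewrite mulrnAC -(morphDMn dlD) yS (morphDB dlD) (morphDMn dlD) dl2.
  by rewrite mul0rn subr0 dlBr.
have -> : (\sum_(i < q.+2) Br (y i) (y (q.+1 - i)%N)) *+ q.+1 =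
    (\sum_(i < q.+1) Br (Br f (y i)) (y (q - i)%N) - Br (dl f) (y q)) *+ 2.
  have -> : (\sum_(i < q.+2) Br (y i) (y (q.+1 - i)%N)) *+ q.+1 =
      (\sum_(i < q.+2) Br (y i) (y (q.+1 - i)%N) *+ i) *+ 2.
    rewrite mulr2n.
    rewrite {2}(sum_conv_rev (fun i j => Br (y i) (y j) *+ i)) -big_split /=.
    rewrite -sumrMnl; apply: eq_bigr => i _.
    by rewrite [Br (y (_ - _)%N) _]BrC // -mulrnDr subnKC // leq_ord.
  (* The term i = 0 has weight 0; after the shift to i + 1 the flow equation applies, and delta f
     enters only at the new i = 0. *)
  congr (_ *+ 2); rewrite big_ord_recl mulr0n add0r.
  rewrite (eq_bigr (fun i : 'I_q.+1 => Br (Br f (y i)) (y (q - i)%N) -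
      Br (dl f) (y (q - i)%N) *+ (i == 0 :> nat))) => [|i _].
    rewrite sumrB [X in _ - X]big_ord_recl /= subn0.
    by rewrite [X in _ - (_ + X)]big1 ?addr0.
  rewrite /= /bump /= add1n subSS -(morphDMn (BrDl _)) yS.
  by rewrite (morphDB (BrDl _)) (morphDMn (BrDl _)).
by rewrite mulrnBl mulrnDl addrC addrA subrK addrC.
Qed.

(** Uniqueness for the linear equation F' = [f, F]: torsion-freeness allows cancelling the factor q
    + 1. *)
Lemma MC_flow_eq0 q : MC_flow 0 = 0 -> MC_flow q = 0.
Proof.
move=> F0; elim: q => // q IH; apply: (@torsion_free q).
by rewrite MC_flowS IH (morphD0 (BrDr f)).
Qed.

End GaugeFlow.

(** * Homogeneous components of a grading *)

Section Components.
Variables (V : zmodType) (G : bool -> set V).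
Hypothesis gG : is_grading G.

Lemma gradingN p v : G p v -> G p (- v).
Proof. by move=> Gv; rewrite -sub0r; apply: (gradingB gG) => //; apply: grading0. Qed.

Lemma gradingD p u v : G p u -> G p v -> G p (u + v).
Proof. by move=> Gu Gv; rewrite -[v]opprK; apply: (gradingB gG) => //; apply: gradingN. Qed.

Lemma grading_bigsum p I (r : seq I) (P : pred I) (F : I -> V) :
  (forall i, P i -> G p (F i)) -> G p (\sum_(i <- r | P i) F i).
Proof.
move=> GF; apply: (big_ind (fun v => G p v)) => //; first exact: grading0.
exact: gradingD.
Qed.

(** [component] is picked by choice; two candidates differ by an element of both parities, which is
    0. *)
Lemma componentE p u v : G p u -> G (~~ p) v -> component G p (u + v) = u.
Proof.
move=> Gu Gv.
have E : [set a | G p a /\ G (~~ p) (u + v - a)] u.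
  by split=> //; rewrite [u + v]addrC addrK.
rewrite /component; case: xgetP => [a _ [Ga Gva]|/(_ _ E)[]//].
have G1 : G p (a - u) by exact: gradingB.
have G2 : G (~~ p) (a - u).
  rewrite -[a - u]opprK opprB.
  have -> : u - a = (u + v - a) - v by rewrite addrAC addrK.
  by apply: gradingN; apply: (gradingB gG).
apply/eqP; rewrite -subr_eq0; apply/eqP.
by case: p {Gu Gv E Ga Gva} G1 G2 => G1 G2; apply: (grading_direct gG).
Qed.

Lemma component_split p v : exists u u', [/\ G p u, G (~~ p) u' & v = u + u'].
Proof.
have [u0 [u1 [G0 G1 ->]]] := grading_sum gG v.
by case: p; [exists u1, u0; rewrite addrC | exists u0, u1].
Qed.

Lemma componentD p : {morph component G p : u v / u + v}.
Proof.
move=> a b; have [u [u' [Gu Gu' ->]]] := component_split p a.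
have [v [v' [Gv Gv' ->]]] := component_split p b.
by rewrite addrACA !componentE //; exact: gradingD.
Qed.

End Components.

(** * Division by positive integers *)

Section RationalScalars.
Variables (A : pzRingType) (qA : {rmorphism rat -> A}).

Lemma qA_invK m a : (qA m.+1%:R^-1 * a) *+ m.+1 = a.
Proof.
rewrite -mulr_natl mulrA -(rmorph_nat qA) -rmorphM mulfV ?rmorph1 ?mul1r //.
by rewrite Num.Theory.pnatr_eq0.
Qed.

Lemma mulrn_torsion_free m (a : A) : a *+ m.+1 = 0 -> a = 0.
Proof. by move=> a0; rewrite -(qA_invK m a) -mulrnAr a0 mulr0. Qed.

(** An additive description of division by m + 1, through which additive maps are seen to commute
    with it. *)
Lemma qA_inv_eq m a b : b *+ m.+1 = a -> b = qA m.+1%:R^-1 * a.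
Proof. by move=> <-; rewrite mulrnAr qA_invK. Qed.

Lemma qA_invS m n a :
  (qA (m.+1 * n.+1)%:R^-1 * a) *+ m.+1 = qA n.+1%:R^-1 * a.
Proof.
apply: qA_inv_eq; rewrite -mulrnA.
by have -> : (m.+1 * n.+1 = (m.+1 * n.+1).-1.+1)%N by []; rewrite qA_invK.
Qed.

End RationalScalars.

(** * Identities of the bracket on the algebra *)

Section DGBVBracket.
Variables (k : pzRingType) (kG : bool -> set k) (A : pzRingType)
  (AG : bool -> set A) (phi : {rmorphism k -> A}) (Delta delta : A -> A).
Hypothesis hA : is_DGBV kG AG phi Delta delta.

Let hGBV := DGBV_GBV hA.
Let gring := graded_comm_alg_ring (GBV_alg hGBV).
Let gG : is_grading AG := graded_comm_ring_grading gring.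
Let DD : {morph Delta : a b / a + b} := odd_linearD (GBV_odd_linear hGBV).
Let dD : {morph delta : a b / a + b} := odd_linearD (DGBV_odd_linear hA).
Let DP p a : AG p a -> AG (~~ p) (Delta a).
Proof. exact: (odd_linear_parity (GBV_odd_linear hGBV)). Qed.
Let dP p a : AG p a -> AG (~~ p) (delta a).
Proof. exact: (odd_linear_parity (DGBV_odd_linear hA)). Qed.
Let D2 := GBV_square hGBV.
Let dDelta a : delta (Delta a) = - Delta (delta a).
Proof. by apply/eqP; rewrite -addr_eq0 (DGBV_anticomm hA). Qed.
Local Notation br := (bracket AG Delta).

Lemma bracketDl b : {morph br^~ b : a a' / a + a'}.
Proof.
move=> a a'; rewrite /bracket -big_split; apply: eq_bigr => p _ /=.
rewrite (componentD gG) -mulrDr -subrACA3 !mulrDl !DD mulrDl.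
by rewrite [(-1) ^+ p * (_ * _ + _)]mulrDr.
Qed.

Lemma bracketDr a : {morph br a : b b' / b + b'}.
Proof.
move=> b b'; rewrite /bracket -big_split; apply: eq_bigr => p _ /=.
rewrite -mulrDr -subrACA3; congr (_ * (_ - _ - _)); first by rewrite mulrDr DD.
  by rewrite mulrDr.
by rewrite DD !mulrDr.
Qed.

(** The case of a gauge parameter: the coefficients of Delta w, for w even, are odd and killed by
    Delta. *)
Lemma bracket_odd a b : AG true a -> Delta a = 0 ->
  br a b = - (Delta (a * b) + a * Delta b).
Proof.
move=> Ga Da; rewrite (bracket_homogeneous _ gG (morphD0 DD) Ga).
by rewrite Da mul0r subr0 expr1 !mulN1r opprK.
Qed.

Lemma bracket_even a b : AG false a ->
  br a b = Delta (a * b) - Delta a * b - a * Delta b.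
Proof.
move=> Ga; rewrite (bracket_homogeneous _ gG (morphD0 DD) Ga).
by rewrite expr0 !mul1r.
Qed.

Lemma bracket_odd_even a b : AG true a -> Delta a = 0 -> AG false b ->
  AG false (br a b).
Proof.
move=> Ga Da Gb; rewrite bracket_odd //; apply: (gradingN gG).
apply: (gradingD gG); first by apply: (DP (p := true)); apply: (gradedM gring Ga Gb).
exact: (gradedM gring Ga (DP Gb)).
Qed.

(** Even elements commute with homogeneous ones without sign, so exchanging a and b only swaps the
    last two terms of [bracket_even]. *)
Lemma bracketC a b : AG false a -> AG false b -> br a b = br b a.
Proof.
move=> Ga Gb; rewrite !bracket_even //.
rewrite (graded_mulC gring Ga Gb) (graded_mulC gring Ga (DP Gb)).
rewrite (graded_mulC gring (DP Ga) Gb) /= expr0 !mul1r.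
by rewrite -!addrA [X in _ + X]addrC.
Qed.

Lemma delta_bracket a b : AG true a -> Delta a = 0 ->
  delta (br a b) = br (delta a) b + br a (delta b).
Proof.
move=> Ga Da; rewrite !(bracket_odd _ Ga Da) (bracket_even _ (dP Ga)).
(* By anticommutation delta a is also killed by Delta, so the middle term of [delta a, b]
   vanishes. *)
have -> : Delta (delta a) = 0 by rewrite -[LHS]opprK -dDelta Da (morphD0 dD) oppr0.
rewrite mul0r subr0 (morphDN dD) dD dDelta !(DGBV_derivation hA _ Ga).
rewrite !expr1 !mulN1r dDelta DD (morphDN DD) mulrN opprK.
rewrite !opprD !opprK -!addrA; congr (_ + _).
exact: addrCA.
Qed.

(** As Delta squares to 0, both sides reduce to - Delta (a * Delta b). *)
Lemma Delta_bracket a b : AG true a -> Delta a = 0 ->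
  Delta (br a b) = br a (Delta b).
Proof.
move=> Ga Da; rewrite !bracket_odd // D2 mulr0 addr0.
by rewrite (morphDN DD) DD D2 add0r.
Qed.

(* For a odd with Delta a = 0, [a, _] is a derivation of the product commuting
   with Delta, hence a derivation of the bracket built from both. *)
Lemma bracket_jacobi a b c :
    AG true a -> Delta a = 0 -> AG false b -> AG false c ->
  br a (br b c) = br (br a b) c + br b (br a c).
Proof.
move=> Ga Da Gb Gc.
have Leib p q u v : AG p u -> AG q v -> br a (u * v) = br a u * v + u * br a v.
  by move=> Gu Gv; rewrite (GBV_Leibniz hGBV Ga Gu Gv) /= expr0 mul1r.
rewrite (bracket_even _ (bracket_odd_even Ga Da Gb)) !(bracket_even _ Gb).
rewrite !(morphDB (bracketDr a)) -Delta_bracket // (Leib _ _ _ _ Gb Gc).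
rewrite (Leib _ _ _ _ (DP Gb) Gc) (Leib _ _ _ _ Gb (DP Gc)) -!Delta_bracket //.
by rewrite DD subrACA3.
Qed.

(** Only the term - Delta (a * b) survives; this keeps the gauge corrections in Im Delta. *)
Lemma bracket_range a b : AG true a -> Delta a = 0 -> Delta b = 0 ->
  range Delta (br a b).
Proof.
move=> Ga Da Db; exists (- (a * b)) => //.
by rewrite bracket_odd // Db mulr0 addr0 (morphDN DD).
Qed.

(** * The bracket on power series in t *)

Local Notation fbr := (fps_bracket AG Delta).
Implicit Types f g h : fps A.

Let even_fps : set (fps A) := [set g | forall n, AG false (g n)].
Let odd_cycle : set (fps A) :=
  [set f | forall n, AG true (f n) /\ Delta (f n) = 0].

Lemma fps_addE f g n : (f + g) n = f n + g n.
Proof. by []. Qed.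

Lemma fps_bracketDl g : {morph fbr^~ g : f f' / f + f'}.
Proof.
move=> f f'; apply: funext => n; rewrite [RHS]fps_addE /fps_bracket.
by rewrite -big_split; apply: eq_bigr => i _; rewrite /= -bracketDl.
Qed.

Lemma fps_bracketDr f : {morph fbr f : g g' / g + g'}.
Proof.
move=> g g'; apply: funext => n; rewrite [RHS]fps_addE /fps_bracket.
by rewrite -big_split; apply: eq_bigr => i _; rewrite /= -bracketDr.
Qed.

Lemma fps_deltaD : {morph (fun g : fps A => (delta \o g : fps A)) : g g' / g + g'}.
Proof. by move=> g g'; apply: funext => n; apply: dD. Qed.

Lemma fps_bracket_even f g : odd_cycle f -> even_fps g -> even_fps (fbr f g).
Proof.
move=> Of Eg n; apply: (grading_bigsum gG) => i _.
by have [Gf Df] := Of i; apply: bracket_odd_even.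
Qed.

Lemma fps_bracketC f g : even_fps f -> even_fps g -> fbr f g = fbr g f.
Proof.
move=> Ef Eg; apply: funext => n; rewrite /fps_bracket.
rewrite (sum_conv_rev (fun i j => br (f i) (g j))).
by apply: eq_bigr => i _; apply: bracketC.
Qed.

Lemma fps_delta_bracket f g : odd_cycle f ->
  delta \o fbr f g = fbr (delta \o f) g + fbr f (delta \o g).
Proof.
move=> Of; apply: funext => n; rewrite [RHS]fps_addE /fps_bracket.
rewrite /= (morphD_sum dD) -big_split; apply: eq_bigr => i _ /=.
by have [Gf Df] := Of i; apply: delta_bracket.
Qed.

(** All double sums are reindexed with the index of f outermost and that of g next; the identity
    then holds term by term. *)
Lemma fps_jacobi f g h : odd_cycle f -> even_fps g -> even_fps h ->
  fbr f (fbr g h) = fbr (fbr f g) h + fbr g (fbr f h).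
Proof.
move=> Of Eg Eh; apply: funext => n; rewrite [RHS]fps_addE /fps_bracket.
have -> : \sum_(i < n.+1) br (\sum_(j < i.+1) br (f j) (g (i - j)%N)) (h (n - i)%N) =
    \sum_(i < n.+1) \sum_(j < (n - i).+1)
      br (br (f i) (g j)) (h (n - i - j)%N).
  rewrite -(sum_triangle (fun i j => br (br (f i) (g j)) (h (n - i - j)%N))).
  apply: eq_bigr => i _; rewrite (morphD_sum (bracketDl _)).
  apply: eq_bigr => j _; congr (br _ (h _)).
  by rewrite -subnDA subnKC // leq_ord.
have -> : \sum_(i < n.+1) br (g i)
      (\sum_(j < (n - i).+1) br (f j) (h (n - i - j)%N)) =
    \sum_(i < n.+1) \sum_(j < (n - i).+1)
      br (g j) (br (f i) (h (n - i - j)%N)).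
  rewrite (sum_triangleC (fun i j => br (g j) (br (f i) (h (n - i - j)%N)))).
  apply: eq_bigr => i _; rewrite (morphD_sum (bracketDr _)).
  by apply: eq_bigr => j _; rewrite subnAC.
rewrite -big_split; apply: eq_bigr => i _ /=.
rewrite (morphD_sum (bracketDr _)) -big_split; apply: eq_bigr => j _ /=.
by have [Gf Df] := Of i; apply: bracket_jacobi.
Qed.

Lemma fps_bracket_order f g p q n :
    (forall i, (i < p)%N -> f i = 0) -> (forall i, (i < q)%N -> g i = 0) ->
  (n < p + q)%N -> fbr f g n = 0.
Proof.
move=> f0 g0 npq; rewrite /fps_bracket big1 // => i _.
have [ip|pi] := ltnP i p; first by rewrite f0 // (morphD0 (bracketDl _)).
rewrite g0 ?(morphD0 (bracketDr _)) // ltn_subLR ?leq_ord //.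
by apply: leq_trans npq _; rewrite leq_add2r.
Qed.

(** Each bracket raises the order in t and g starts at order one, which gains the case n = q over
    [iter_bracket_eq0]. *)
Lemma iter_fps_bracket_order f g q n :
  f 0%N = 0 -> g 0%N = 0 -> (n <= q)%N -> iter q (fbr f) g n = 0.
Proof.
move=> f0 g0; elim: q n => [|q IH] n; first by rewrite leqn0 => /eqP->.
move=> nq; apply: (@fps_bracket_order _ _ 1 q.+1); last by rewrite add1n.
  by case.
by move=> i; rewrite ltnS; apply: IH.
Qed.

(** A coefficient of index n could only occur paired with a constant term, and these vanish. *)
Lemma fps_bracket_congr f f' g g' n :
    f 0%N = 0 -> f' 0%N = 0 -> g 0%N = 0 -> g' 0%N = 0 ->
    (forall i, (i < n)%N -> f i = f' i) -> (forall i, (i < n)%N -> g i = g' i) ->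
  fbr f g n = fbr f' g' n.
Proof.
move=> f0 f0' g0 g0' ff gg; apply: eq_bigr => -[i /= ilt] _.
case: i ilt => [|i] ilt; first by rewrite f0 f0' !(morphD0 (bracketDl _)).
rewrite ltnS leq_eqVlt in ilt; have [Ein|ltin] := orP ilt.
  by rewrite (eqP Ein) subnn g0 g0' !(morphD0 (bracketDr _)).
by rewrite ff // gg // ltn_subrL /= (leq_ltn_trans _ ltin).
Qed.

Lemma iter_fps_bracket_congr f f' g g' q n :
    f 0%N = 0 -> f' 0%N = 0 -> g 0%N = 0 -> g' 0%N = 0 ->
    (forall i, (i < n)%N -> f i = f' i) -> (forall i, (i < n)%N -> g i = g' i) ->
  iter q.+1 (fbr f) g n = iter q.+1 (fbr f') g' n.
Proof.
move=> f0 f0' g0 g0'; elim: q n => [|q IH] n ff gg; first exact: fps_bracket_congr.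
rewrite iterS [in RHS]iterS; apply: fps_bracket_congr => //.
- exact: iter_fps_bracket_order.
- exact: iter_fps_bracket_order.
- move=> i ltin; apply: IH => j ltji; [apply: ff | apply: gg]; exact: ltn_trans ltin.
Qed.

(** * The gauge action and its flow *)

Variable qA : {rmorphism rat -> A}.
Hypothesis qA_even : forall c, AG false (qA c).
Local Notation gaugeA := (gauge AG Delta delta qA).

(** Every term with at least one bracket depends only on coefficients of f below n; f n itself
    enters only through - delta (f n), the q = 0 term of the second sum. *)
Lemma gauge_change f f' x n :
    f 0%N = 0 -> f' 0%N = 0 -> x 0%N = 0 -> (forall i, (i < n)%N -> f i = f' i) ->
  gaugeA f x n = gaugeA f' x n - delta (f n - f' n).
Proof.
move=> f0 f0' x0 ff; rewrite /gauge.
have d0 f1 : f1 0%N = 0 -> (delta \o f1) 0%N = 0 by move=> /= ->; rewrite (morphD0 dD).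
rewrite !big_ord_recl /= !fact0 invr1 rmorph1 !mul1r.
rewrite [X in x n + X - _](eq_bigr (fun i : 'I_n => qA ((bump 0 i)`!%:R^-1) *
  iter i.+1 (fbr f') x n)); last first.
  by move=> i _; congr (_ * _); apply: iter_fps_bracket_congr.
rewrite [X in _ - (_ + X)](eq_bigr (fun i : 'I_n => qA ((bump 0 i).+1`!%:R^-1) *
  iter i.+1 (fbr f') (delta \o f') n)); last first.
  move=> i _; congr (_ * _); apply: iter_fps_bracket_congr => //; try exact: d0.
  by move=> j jn /=; rewrite ff.
rewrite -[RHS]addrA -opprD (morphDB dD); congr (_ - _).
by rewrite [RHS]addrC addrA subrK.
Qed.

Lemma gauge_congr f f' x n :
    f 0%N = 0 -> f' 0%N = 0 -> x 0%N = 0 -> (forall i, (i <= n)%N -> f i = f' i) ->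
  gaugeA f x n = gaugeA f' x n.
Proof.
move=> f0 f0' x0 ff; rewrite (gauge_change f0 f0' x0) => [|i /ltnW]; last exact: ff.
by rewrite ff // subrr (morphD0 dD) subr0.
Qed.

Lemma gauge0 f x : f 0%N = 0 -> x 0%N = 0 -> gaugeA f x 0%N = 0.
Proof.
move=> f0 x0; rewrite /gauge !big_ord1 /= f0 x0 (morphD0 dD).
by rewrite !mulr0 subrr.
Qed.

(** This is q! times the coefficient of s^q. As delta f carries a factor s of its own, it receives
    one bracket fewer than x. *)
Definition gauge_term f x q : fps A :=
  iter q (fbr f) x - (if q is p.+1 then iter p (fbr f) (delta \o f) else 0).

(* Coefficient of s^q in exp(s f) . x. *)
Definition gauge_flow f x q : fps A :=
  fun n => qA q`!%:R^-1 * gauge_term f x q n.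

Lemma fps_mulrnE g m n : (g *+ m) n = g n *+ m.
Proof. by elim: m => // m IH; rewrite !mulrS -IH. Qed.

Lemma fps_torsion_free m g : g *+ m.+1 = 0 -> g = 0.
Proof.
move=> g0; apply: funext => n; apply: (mulrn_torsion_free qA (m := m)).
by rewrite -fps_mulrnE g0.
Qed.

Lemma fps_bracket_qA f g m :
  fbr f (fun n => qA m.+1%:R^-1 * g n) = (fun n => qA m.+1%:R^-1 * fbr f g n).
Proof.
apply: funext => n; apply: qA_inv_eq.
rewrite -fps_mulrnE -(morphDMn (fps_bracketDr f)); congr (fbr f _ n).
by apply: funext => i; rewrite fps_mulrnE qA_invK.
Qed.

Lemma gauge_termS f x q :
  gauge_term f x q.+1 = fbr f (gauge_term f x q) - (delta \o f : fps A) *+ (q == 0%N).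
Proof.
rewrite /gauge_term (morphDB (fps_bracketDr f)).
case: q => [|q] /=; first by rewrite (morphD0 (fps_bracketDr f)) subr0.
by rewrite subr0.
Qed.

Lemma gauge_flowS f x q :
  gauge_flow f x q.+1 *+ q.+1 =
  fbr f (gauge_flow f x q) - (delta \o f : fps A) *+ (q == 0%N).
Proof.
have qf : q`! = (q`!).-1.+1 by rewrite prednK ?fact_gt0.
apply: funext => n; rewrite fps_mulrnE /gauge_flow factS qf qA_invS.
rewrite fps_bracket_qA gauge_termS !mulrDr; congr (_ + _).
by case: q qf => [|q] _ //=; rewrite ?invr1 ?rmorph1 ?mul1r // oppr0 mulr0.
Qed.

Lemma fps_delta_even f : odd_cycle f -> even_fps (delta \o f).
Proof. by move=> Of n; have [Gf _] := Of n; apply: (dP Gf). Qed.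

Lemma iter_fps_bracket_even f g q :
  odd_cycle f -> even_fps g -> even_fps (iter q (fbr f) g).
Proof. by move=> Of Eg; elim: q => //= q; apply: fps_bracket_even. Qed.

Lemma gauge_flow_even f x q :
  odd_cycle f -> even_fps x -> even_fps (gauge_flow f x q).
Proof.
move=> Of Ex n; apply: (gradedM gring (qA_even _)).
apply: (gradingB gG); first exact: iter_fps_bracket_even.
case: q => [|q]; first exact: (grading0 gG).
by apply: iter_fps_bracket_even => //; apply: fps_delta_even.
Qed.

(** The delta f part has only q - 1 brackets, but delta f has no constant term, which restores order
    q. *)
Lemma gauge_flow_order f x q n :
  f 0%N = 0 -> x 0%N = 0 -> (n < q)%N -> gauge_flow f x q n = 0.
Proof.
move=> f0 x0; rewrite /gauge_flow /gauge_term; case: q => // q nq.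
rewrite [X in _ * X](_ : _ = 0) ?mulr0 //.
rewrite [LHS]fps_addE (iter_fps_bracket_order f0 x0 (ltnW nq)) add0r.
have d0 : (delta \o f) 0%N = 0 by rewrite /= f0 (morphD0 dD).
have := iter_fps_bracket_order f0 d0 (nq : (n <= q)%N).
by move=> /(congr1 -%R); rewrite oppr0.
Qed.

Lemma gauge_sum_flow f x n N : f 0%N = 0 -> x 0%N = 0 -> (n < N)%N ->
  gaugeA f x n = \sum_(q < N) gauge_flow f x q n.
Proof.
move=> f0 x0 nN; rewrite (gauge_stable _ _ _ gG (morphD0 DD) f0 nN).
case: N nN => // N nN.
(* The last term of the second sum vanishes for reasons of order; dropping it aligns the two sums,
   which are shifted by one. *)
rewrite [X in _ - X]big_ord_recr /= iter_fps_bracket_order //; last first.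
  by rewrite /= f0 (morphD0 dD).
rewrite mulr0 addr0 !big_ord_recl -addrA -sumrB /=; congr (_ + _).
  by rewrite /gauge_flow /gauge_term subr0.
by apply: eq_bigr => i _; rewrite -mulrBr.
Qed.

Lemma gauge_even f x : f 0%N = 0 -> x 0%N = 0 -> odd_cycle f -> even_fps x ->
  even_fps (gaugeA f x).
Proof.
move=> f0 x0 Of Ex n; rewrite (gauge_sum_flow f0 x0 (ltnSn n)).
by apply: (grading_bigsum gG) => q _; apply: gauge_flow_even.
Qed.

Lemma Maurer_CartanE x :
  Maurer_Cartan AG Delta delta qA x <->
  forall n, delta (x n) *+ 2 + fbr x x n = 0.
Proof.
have E n : (delta (x n) + qA 2%:R^-1 * fbr x x n) *+ 2 =
    delta (x n) *+ 2 + fbr x x n.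
  by rewrite mulrnDl qA_invK.
split=> MC n; first by rewrite -E MC mul0rn.
by apply: (mulrn_torsion_free qA (m := 1)); rewrite E.
Qed.

Lemma gauge_MC f x : f 0%N = 0 -> x 0%N = 0 -> odd_cycle f -> even_fps x ->
  Maurer_Cartan AG Delta delta qA x ->
  Maurer_Cartan AG Delta delta qA (gaugeA f x).
Proof.
move=> f0 x0 Of Ex /Maurer_CartanE MCx; apply/Maurer_CartanE => n.
pose y := gauge_flow f x; pose dl g : fps A := delta \o g.
have y0 : y 0%N = x.
  by apply: funext => i; rewrite /y /gauge_flow /gauge_term subr0 invr1 rmorph1 mul1r.
have F0 : MC_flow fbr dl y 0 = 0.
  apply: funext => i; rewrite /MC_flow big_ord1 /= y0.
  by rewrite [LHS]fps_addE fps_mulrnE; apply: MCx.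
have Fq q : MC_flow fbr dl y q = 0.
  apply: (@MC_flow_eq0 _ fbr dl even_fps f fps_torsion_free) => //.
  - exact: fps_bracketDl.
  - exact: fps_bracketDr.
  - exact: fps_deltaD.
  - by apply: funext => i; apply: (DGBV_square hA).
  - by move=> g; apply: fps_bracket_even.
  - exact: fps_bracketC.
  - by move=> g _; apply: fps_delta_bracket.
  - by move=> g h; apply: fps_jacobi.
  - by move=> i; apply: gauge_flow_even.
  - exact: gauge_flowS.
have evalD : {morph (fun g : fps A => g n) : g h / g + h} by [].
(* Evaluation at s = 1: up to t^n, the gauge transform is the finite sum of the y_q with q <= n. *)
have -> : fbr (gaugeA f x) (gaugeA f x) n =
    \sum_(q < n.+1) \sum_(r < n.+1) fbr (y q) (y r) n.
  rewrite /fps_bracket.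
  under [RHS]eq_bigr => q _ do rewrite exchange_big.
  rewrite [RHS]exchange_big; apply: eq_bigr => i _ /=.
  rewrite (gauge_sum_flow f0 x0 (ltn_ord i)).
  rewrite (gauge_sum_flow f0 x0 (_ : n - i < n.+1)%N) ?ltnS ?leq_subr //.
  rewrite (morphD_sum (bracketDl _)). apply: eq_bigr => q _.
  by rewrite (morphD_sum (bracketDr _)).
(* Since y_q has order at least q in t, pairs with q + r > n drop out, and grouping by q + r yields
   the coefficients of the curvature. *)
rewrite (@sum_square _ (fun q r => fbr (y q) (y r) n) _ n) //; last first.
  move=> i j nij; apply: (fps_bracket_order _ _ nij) => m;
  exact: gauge_flow_order.
rewrite (gauge_sum_flow f0 x0 (ltnSn n)) (morphD_sum dD) -sumrMnl -big_split /=.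
rewrite big1 // => q _; have := congr1 (fun g : fps A => g n) (Fq q).
rewrite /MC_flow [X in X = _ -> _]fps_addE fps_mulrnE.
by rewrite (morphD_sum evalD).
Qed.

(** * Image of Delta, parity of preimages and comparison of Maurer-Cartan solutions *)

Lemma range_DeltaD a b : range Delta a -> range Delta b -> range Delta (a + b).
Proof. by move=> [u _ <-] [v _ <-]; exists (u + v) => //; rewrite DD. Qed.

Lemma range_DeltaN a : range Delta a -> range Delta (- a).
Proof. by move=> [u _ <-]; exists (- u) => //; rewrite (morphDN DD). Qed.

Lemma range_Delta_sum I (r : seq I) (F : I -> A) :
  (forall i, range Delta (F i)) -> range Delta (\sum_(i <- r) F i).
Proof.
move=> RF; apply: (big_ind (range Delta)) => //; last exact: range_DeltaD.
by exists 0 => //; rewrite (morphD0 DD).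
Qed.

Lemma range_Delta_qA m a : (0 < m)%N -> range Delta a ->
  range Delta (qA m%:R^-1 * a).
Proof.
case: m => // m _ [u _ <-]; exists (qA m.+1%:R^-1 * u) => //.
by apply: qA_inv_eq; rewrite -(morphDMn DD) qA_invK.
Qed.

Lemma fps_bracket_range f g : odd_cycle f -> (forall n, Delta (g n) = 0) ->
  forall n, range Delta (fbr f g n).
Proof.
move=> Of Dg n; apply: range_Delta_sum => i.
by have [Gf Df] := Of i; apply: bracket_range.
Qed.

Lemma iter_fps_bracket_range f g q : odd_cycle f -> (forall n, Delta (g n) = 0) ->
  forall n, range Delta (iter q.+1 (fbr f) g n).
Proof.
move=> Of Dg; elim: q => [|q IH] n; first exact: fps_bracket_range.
by apply: fps_bracket_range => // i; have [u _ uE] := IH i; have := D2 u; rewrite uE.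
Qed.

(** Apart from x n, every term is a rational multiple of delta (f n) or of an iterated bracket of
    series killed by Delta. *)
Lemma gauge_sub_range f x n : odd_cycle f -> (forall n, Delta (x n) = 0) ->
  (forall n, range Delta (f n)) -> range Delta (gaugeA f x n - x n).
Proof.
move=> Of Dx Rf; rewrite /gauge big_ord_recl /= invr1 rmorph1 mul1r.
rewrite addrAC [x n + _]addrC addrK.
have Rd i : range Delta (delta (f i)).
  have [u _ <-] := Rf i; exists (- delta u) => //.
  by rewrite (morphDN DD) dDelta.
have Dd i : Delta ((delta \o f) i) = 0 by rewrite /=; have [u _ <-] := Rd i.
apply: range_DeltaD; last apply: range_DeltaN; apply: range_Delta_sum => i.
  by apply: range_Delta_qA; rewrite ?fact_gt0 //; apply: iter_fps_bracket_range.
apply: range_Delta_qA; rewrite ?fact_gt0 //.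
by case: (i : nat) => [|q]; [apply: Rd | apply: iter_fps_bracket_range].
Qed.

(** The even part of any preimage serves as u: the remainder is even, yet it is also delta Delta of
    the odd part, hence odd. *)
Lemma even_deltaDelta a : AG false a -> range (delta \o Delta) a ->
  exists2 u, AG false u & a = delta (Delta u).
Proof.
move=> Ga [v _ vE]; have [u0 [u1 [G0 G1 Ev]]] := grading_sum gG v.
exists u0 => //; apply/eqP; rewrite -subr_eq0; apply/eqP.
have E : a - delta (Delta u0) = delta (Delta u1).
  by rewrite -vE /= Ev DD dD addrC addKr.
apply: (grading_direct gG); last by rewrite E; apply: dP (DP G1).
by apply: (gradingB gG) => //; apply: dP (DP G0).
Qed.

(** The quadratic term at t^n involves only lower coefficients, so it agrees for x and y. *)
Lemma MC_delta_eq x y n :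
    Maurer_Cartan AG Delta delta qA x -> Maurer_Cartan AG Delta delta qA y ->
    x 0%N = 0 -> y 0%N = 0 -> (forall i, (i < n)%N -> x i = y i) ->
  delta (x n) = delta (y n).
Proof.
move=> MCx MCy x0 y0 xy; apply: (addIr (qA (2%:R^-1) * fbr x x n)).
by rewrite MCx (@fps_bracket_congr x y x y) // MCy.
Qed.

(** * Recursive construction of w *)

Hypothesis hdD : deltaDelta_condition delta Delta.
Variables x xbar : fps A.
Hypotheses (x0 : x 0%N = 0) (xbar0 : xbar 0%N = 0).
Hypotheses (x_even : even_fps x) (xbar_even : even_fps xbar).
Hypotheses (x_MC : Maurer_Cartan AG Delta delta qA x)
  (xbar_MC : Maurer_Cartan AG Delta delta qA xbar).
Hypothesis Dx : forall n, Delta (x n) = 0.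
Hypothesis x_xbar : forall n, range Delta (x n - xbar n).

Definition gauge_approx n (w : fps A) :=
  [/\ w 0%N = 0, even_fps w &
      forall i, (i <= n)%N -> gaugeA (Delta \o w) x i = xbar i].

Lemma Delta_odd_cycle w : even_fps w -> odd_cycle (Delta \o w).
Proof. by move=> Ew n; split; [apply: (DP (Ew n)) | apply: D2]. Qed.

Lemma gauge_approxS n w : gauge_approx n w ->
  exists w', gauge_approx n.+1 w' /\ forall i, (i <= n)%N -> w' i = w i.
Proof.
move=> [w0 Ew gw]; pose f := Delta \o w; pose y := gaugeA f x.
have f0 : f 0%N = 0 by rewrite /f /= w0 (morphD0 DD).
have Of : odd_cycle f := Delta_odd_cycle Ew.
have Ey : even_fps y := gauge_even f0 x0 Of x_even.
have yMC := gauge_MC f0 x0 Of x_even x_MC.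
have dE : delta (y n.+1) = delta (xbar n.+1).
  by apply: MC_delta_eq => //; apply: gauge0.
have RE : range Delta (y n.+1 - xbar n.+1).
  (* Passing through x: both y - x and x - xbar have coefficients in Im Delta. *)
  rewrite -[y n.+1](subrK (x n.+1)) -addrA; apply: range_DeltaD => //.
  by apply: gauge_sub_range => // i; exists (w i).
have [u Gu uE] : exists2 u, AG false u & y n.+1 - xbar n.+1 = delta (Delta u).
  apply: even_deltaDelta; first exact: (gradingB gG).
  have [-> ->] := hdD; split=> //.
  by rewrite /ker /= (morphDB dD) dE subrr.
pose w' i := if i == n.+1 then w i + u else w i.
have w'E i : (i <= n)%N -> w' i = w i.
  by move=> ilen; rewrite /w'; case: eqP => // iE; rewrite iE ltnn in ilen.
have f'0 : (Delta \o w') 0%N = 0 by rewrite /= w'E // w0 (morphD0 DD).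
exists w'; split=> //; split=> [|i|i].
- by rewrite w'E.
- by rewrite /w'; case: eqP => _ //; apply: (gradingD gG).
rewrite leq_eqVlt => /orP[/eqP->|ilen].
  (* The new coefficient is y_(n+1) - delta (Delta u), that is xbar_(n+1) by the choice of u. *)
  rewrite (gauge_change f'0 f0 x0) => [|j jn]; last by rewrite /= w'E.
  rewrite /f /= {1}/w' eqxx DD [Delta (w _) + _]addrC addrK -uE.
  by rewrite opprB addrC subrK.
rewrite (gauge_congr f'0 f0 x0) ?gw // => j jlei.
by rewrite /f /= w'E // (leq_trans jlei).
Qed.

Lemma gauge_equivalent :
  exists w : fps A, [/\ w 0%N = 0, even_fps w & gaugeA (Delta \o w) x = xbar].
Proof.
(* Stated for all pairs so that choice applies; [nw.2] is a default value where the invariant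
   fails. *)
have step (nw : nat * fps A) : exists w', gauge_approx nw.1 nw.2 ->
    gauge_approx nw.1.+1 w' /\ forall i, (i <= nw.1)%N -> w' i = nw.2 i.
  have [/gauge_approxS[w' ?]|nP] := pselect (gauge_approx nw.1 nw.2); first by exists w'.
  by exists nw.2.
have [S SP] := choice step.
pose W := fix W n : fps A := if n is m.+1 then S (m, W m) else fun=> 0.
have WP n : gauge_approx n (W n).
  elim: n => [|n IH]; last by have [] := SP (n, W n) IH.
  split=> // i.
    exact: (grading0 gG).
  by rewrite leqn0 => /eqP->; rewrite xbar0 gauge0 //= (morphD0 DD).
(* Coefficient i is final from stage i on, so the diagonal is the limit. *)
have Wstab n i : (i <= n)%N -> W n i = W i i.
  elim: n => [|n IH]; first by rewrite leqn0 => /eqP->.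
  rewrite leq_eqVlt => /orP[/eqP->//|ilen].
  by have [_ /(_ i ilen) /= ->] := SP (n, W n) (WP n); apply: IH.
exists (fun n => W n n); split=> // [n|]; first by have [] := WP n.
apply: funext => n; have [Wn0 _ gW] := WP n.
rewrite -gW //; apply: gauge_congr => //=; rewrite ?Wn0 ?(morphD0 DD) //.
by move=> i ilen; rewrite Wstab.
Qed.

End DGBVBracket.

(** * From the assumptions on x and xbar to those of the recursion *)

Theorem proposition3p1
  (k : pzRingType) (kG : bool -> set k) (iota : {rmorphism rat -> k})
  (hk : is_graded_comm_alg (@even_grading rat) kG iota)
  (A : pzRingType) (AG : bool -> set A) (phi : {rmorphism k -> A})
  (Delta delta : A -> A)
  (hA : is_DGBV kG AG phi Delta delta)
  (hdD : deltaDelta_condition delta Delta)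
  (x xbar : fps A)
  (x0 : x 0%N = 0) (xbar0 : xbar 0%N = 0)
  (x_even : forall n, AG false (x n))
  (xbar_even : forall n, AG false (xbar n))
  (x_MC : Maurer_Cartan AG Delta delta (phi \o iota) x)
  (xbar_MC : Maurer_Cartan AG Delta delta (phi \o iota) xbar)
  (x1_ker : (ker delta `&` ker Delta) (x 1%N))
  (xbar1_ker : (ker delta `&` ker Delta) (xbar 1%N))
  (x_im : forall n, (1 < n)%N -> range Delta (x n))
  (xbar_im : forall n, (1 < n)%N -> range Delta (xbar n))
  (x1_xbar1 : homology_class delta (x 1%N) = homology_class delta (xbar 1%N)) :
  exists w : fps A,
    [/\ w 0%N = 0,
        forall n, AG true (Delta (w n)) &
        gauge AG Delta delta (phi \o iota) (Delta \o w) x = xbar].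
Proof.
have DD := odd_linearD (GBV_odd_linear (DGBV_GBV hA)).
have dD := odd_linearD (DGBV_odd_linear hA).
have D2 := GBV_square (DGBV_GBV hA).
(* All rationals are even, and both structure maps preserve parity. *)
have qA_even c : AG false ((phi \o iota) c).
  apply: (graded_structure_map (GBV_alg (DGBV_GBV hA))).
  exact: (graded_structure_map hk).
have Dx n : Delta (x n) = 0.
  case: n => [|[|n]]; [by rewrite x0 (morphD0 DD) | by case: x1_ker |].
  by have [u _ <-] := x_im n.+2 isT.
have x_xbar n : range Delta (x n - xbar n).
  case: n => [|[|n]].
  - by exists 0; rewrite // x0 xbar0 (morphD0 DD) subrr.
  - have : (range delta `&` ker Delta) (x 1%N - xbar 1%N).
      split; last first.
        rewrite /ker /= (morphDB DD).
        by case: x1_ker xbar1_ker => _ -> [_ ->]; rewrite subrr.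
      (* x_1 lies in its own coset, hence in xbar_1 + Im delta. *)
      have : homology_class delta (x 1%N) (x 1%N).
        by exists 0; rewrite ?addr0 //; exists 0 => //; exact: (morphD0 dD).
      by rewrite x1_xbar1 => -[b bR <-]; rewrite addrC addKr.
    by have [_ ->] := hdD; case.
  - apply: (range_DeltaD hA); first exact: x_im.
    by apply: (range_DeltaN hA); exact: xbar_im.
have [w [w0 Ew gw]] := gauge_equivalent hA qA_even hdD x0 xbar0 x_even xbar_even
  x_MC xbar_MC Dx x_xbar.
by exists w; split=> // n; have [] := Delta_odd_cycle hA Ew n.
Qed.
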